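(* Let $T$ be a positive theory with the Joint Continuation Property. If $T$ is countable and $\mathsf{NIP}$, then invariant types are Borel-definable. That is, for every pec model $M$ of $T$, every positive formula $\varphi(x;y)$ and every $M$-invariant global (maximal) positive type $p(x)$, the set $d_p\varphi$ is a Borel subset of $S_y(M)$.
   Context: Positive logic: a positive formula is one built from atomic formulas (including equalities) using $\wedge,\vee,\top,\bot,\exists$. An h-inductive sentence is $\forall x\,(\varphi(x)\to\psi(x))$ with $\varphi,\psi$ positive; a positive theory is a consistent set of h-inductive sentences. A homomorphism is a map preserving positive formulas; an immersion is a homomorphism that also reflects positive formulas. A model $M\models T$ is pec (positively existentially closed) if every homomorphism from $M$ to a model of $T$ is an immersion. $T$ has the Joint Continuation Property if any two models of $T$ admit homomorphisms into a common model of $T$. Fix a sufficiently large cardinal $\bar\kappa$; ''small'' means of size $<\bar\kappa$. We work in a monster model $\mathfrak U$: a pec model such that every partial immersion $\mathfrak U\to\mathfrak U$ with small domain extends to an automorphism, and every small finitely satisfiable set of positive formulas over $\mathfrak U$ is satisfiable in $\mathfrak U$. Pec models $M$ are small and contained in $\mathfrak U$ (with $M\to\mathfrak U$ an immersion). A maximal type over $B$ is a maximal consistent set of positive formulas over $B$; a global type is a maximal type over $\mathfrak U$. $S_y(M)$ is the set of maximal types over $M$ in variables $y$, with the topology having as subbasis of open sets the sets $[\neg\varphi(y)]=\{q\in S_y(M):\varphi\notin q\}$ for positive $\varphi(y)$ over $M$. $a\equiv_B a'$ means that $a,a'$ satisfy the same positive formulas over $B$. A positive formula $\varphi(x;y)$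 has $\mathsf{IP}$ if there are a positive $\psi(x;y)$ with $T\models\forall x,y\,\neg(\varphi\wedge\psi)$, a model $A\models T$, and tuples $(a_i)_{i\in\omega}$, $(b_W)_{W\subseteq\omega}$ from $A$ with $A\models\varphi(a_i;b_W)$ for $i\in W$ and $A\models\psi(a_i;b_W)$ for $i\notin W$; otherwise it is $\mathsf{NIP}$. $T$ is $\mathsf{NIP}$ if every positive formula is. A global type $p(x)$ is $M$-invariant if for every positive $\varphi(x;y)$ and $a\equiv_M a'$ in $\mathfrak U$ we have $\varphi(x;a)\in p\iff\varphi(x;a')\in p$. For such $p$, $d_p\varphi:=\{q\in S_y(M):\varphi(x;c)\in p\text{ for some (equivalently, every) } c\models q \text{ in }\mathfrak U\}$. *)

(* Defs.v *)
From HB Require Import structures.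
From mathcomp Require Import all_boot.
From mathcomp Require Import all_classical.
From mathcomp Require Import topology measure.

Set Implicit Arguments.
Unset Strict Implicit.
Unset Printing Implicit Defensive.

Local Open Scope classical_set_scope.
Local Open Scope card_scope.

Record language := Language {
  funcs : Type;
  farity : funcs -> nat;
  rels : Type;
  rarity : rels -> nat }.

(* Variables are elements of an arbitrary type [V]; bound variables are handled
   by passing from [V] to [option V], [None] being the newly bound one.
   A formula phi(x; y) has [V := 'I_n + 'I_m], and a formula in x over a set of
   parameters [B] has [V := 'I_n + B]: parameters are variables whose value is
   prescribed. *)
Inductive term (L : language) (V : Type) : Type :=
| Var of V
| App (f : funcs L) of ('I_(farity f) -> term L V).

Inductive pform (L : language) (V : Type) : Type :=
| PEq of term L V & term L V
| PRel (r : rels L) of ('I_(rarity r) -> term L V)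
| PTop
| PBot
| PAnd of pform L V & pform L V
| POr of pform L V & pform L V
| PEx of pform L (option V).

Fixpoint trename (L : language) (V W : Type) (s : V -> W) (t : term L V) :
    term L W :=
  match t with
  | Var v => Var L (s v)
  | App f args => App (fun i => trename s (args i))
  end.

Fixpoint prename (L : language) (V W : Type) (s : V -> W) (phi : pform L V) :
    pform L W :=
  match phi with
  | PEq t u => PEq (trename s t) (trename s u)
  | PRel r args => PRel (fun i => trename s (args i))
  | PTop => PTop L W
  | PBot => PBot L W
  | PAnd f g => PAnd (prename s f) (prename s g)
  | POr f g => POr (prename s f) (prename s g)
  | PEx f => PEx (prename (omap s) f)
  end.

Record structure (L : language) := Structure {
  carrier :> Type;
  carrier_inhabited : inhabited carrier;
  finterp : forall f : funcs L, ('I_(farity f) -> carrier) -> carrier;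
  rinterp : forall r : rels L, ('I_(rarity r) -> carrier) -> Prop }.

Fixpoint eval (L : language) (A : structure L) (V : Type) (a : V -> A)
    (t : term L V) : A :=
  match t with
  | Var v => a v
  | App f args => finterp (fun i => eval a (args i))
  end.

Definition vcons (A V : Type) (x : A) (a : V -> A) (v : option V) : A :=
  if v is Some w then a w else x.

Fixpoint sat (L : language) (A : structure L) (V : Type) (phi : pform L V)
    (a : V -> A) : Prop :=
  match phi with
  | PEq t u => eval a t = eval a u
  | PRel r args => rinterp (fun i => eval a (args i))
  | PTop => True
  | PBot => False
  | PAnd f g => sat f a /\ sat g a
  | POr f g => sat f a \/ sat g a
  | PEx f => exists x : A, sat f (vcons x a)
  end.

Definition vjoin (A V W : Type) (a : V -> A) (b : W -> A) (v : V + W) : A :=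
  match v with inl i => a i | inr j => b j end.

(* [hsent n phi psi] is the sentence forall x, (phi(x) -> psi(x)). *)
Record hsentence (L : language) := HSentence {
  hvars : nat;
  hprem : pform L 'I_hvars;
  hconc : pform L 'I_hvars }.

Definition theory (L : language) := set (hsentence L).

Definition models (L : language) (A : structure L) (T : theory L) : Prop :=
  forall s, T s -> forall a : 'I_(hvars s) -> A,
    sat (hprem s) a -> sat (hconc s) a.

Definition positive_theory (L : language) (T : theory L) : Prop :=
  exists A : structure L, models A T.

Definition countable_language (L : language) : Prop :=
  countable [set: funcs L] /\ countable [set: rels L].

Definition homomorphism (L : language) (A B : structure L) (h : A -> B) : Prop :=
  forall (n : nat) (phi : pform L 'I_n) (a : 'I_n -> A),
    sat phi a -> sat phi (h \o a).

Definition immersion (L : language) (A B : structure L) (h : A -> B) : Prop :=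
  homomorphism h /\
  forall (n : nat) (phi : pform L 'I_n) (a : 'I_n -> A),
    sat phi (h \o a) -> sat phi a.

Definition pec (L : language) (T : theory L) (A : structure L) : Prop :=
  models A T /\
  forall (B : structure L) (h : A -> B),
    models B T -> homomorphism h -> immersion h.

Definition JCP (L : language) (T : theory L) : Prop :=
  forall A B : structure L, models A T -> models B T ->
  exists (C : structure L) (f : A -> C) (g : B -> C),
    [/\ models C T, homomorphism f & homomorphism g].

(* A cardinal is represented by a type [K]; small sets are those of cardinality
   strictly less than that of [K]. *)
Definition card_lt (S K : Type) (A : set S) (B : set K) : Prop :=
  A #<= B /\ ~ (B #<= A).

Definition small (K S : Type) (A : set S) : Prop := card_lt A [set: K].

(* The values of [f] outside of the domain [D] are irrelevant. *)
Definition partial_immersion (L : language) (A B : structure L) (D : set A)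
    (f : A -> B) : Prop :=
  forall (n : nat) (phi : pform L 'I_n) (a : 'I_n -> A),
    (forall i, D (a i)) -> (sat phi a <-> sat phi (f \o a)).

Definition automorphism (L : language) (A : structure L) (s : A -> A) : Prop :=
  homomorphism s /\
  exists s' : A -> A, [/\ homomorphism s', cancel s s' & cancel s' s].

Definition satisfiable (L : language) (A : structure L) (V : Type)
    (S : set (pform L (V + A))) : Prop :=
  exists a : V -> A, forall phi, S phi -> sat phi (vjoin a id).

Definition finitely_satisfiable (L : language) (A : structure L) (V : Type)
    (S : set (pform L (V + A))) : Prop :=
  forall S0, S0 `<=` S -> finite_set S0 -> satisfiable S0.

Definition monster (L : language) (T : theory L) (K : Type) (U : structure L) :
    Prop :=
  [/\ pec T U,
      forall (D : set U) (f : U -> U), small K D -> partial_immersion D f ->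
        exists2 s : U -> U, automorphism s & forall x, D x -> s x = f x
    & forall (V : Type) (S : set (pform L (V + U))), small K S ->
        finitely_satisfiable S -> satisfiable S].

(* In what follows the parameter set is given by a map [e] from a type [B] to
   the monster model [U]: [id] for global types, the immersion [M -> U] for
   types over [M]. *)

(* Consistency with T and the positive diagram of U. *)
Definition consistent (L : language) (T : theory L) (U : structure L)
    (B V : Type) (e : B -> U) (S : set (pform L (V + B))) : Prop :=
  exists (N : structure L) (h : U -> N) (a : V -> N),
    [/\ models N T, homomorphism h &
        forall phi, S phi -> sat phi (vjoin a (h \o e))].

Definition maximal_type (L : language) (T : theory L) (U : structure L)
    (B V : Type) (e : B -> U) (S : set (pform L (V + B))) : Prop :=
  consistent T e S /\
  forall S' : set (pform L (V + B)), consistent T e S' -> S `<=` S' -> S' = S.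

Definition global_type (L : language) (T : theory L) (U : structure L) (n : nat)
    (p : set (pform L ('I_n + U))) : Prop :=
  maximal_type T (@id U) p.

(* S_y(M), for y a tuple of length m. *)
Definition type_space (L : language) (T : theory L) (U M : structure L)
    (e : M -> U) (m : nat) : Type :=
  {q : set (pform L ('I_m + M)) | maximal_type T e q}.

HB.instance Definition _ L T U M e m :=
  gen_eqMixin (@type_space L T U M e m).
HB.instance Definition _ L T U M e m :=
  gen_choiceMixin (@type_space L T U M e m).

Definition neg_set (L : language) (T : theory L) (U M : structure L)
    (e : M -> U) (m : nat) (phi : pform L ('I_m + M)) :
    set (type_space T e m) :=
  [set q | ~ sval q phi].

Definition neg_sets (L : language) (T : theory L) (U M : structure L)
    (e : M -> U) (m : nat) : set (set (type_space T e m)) :=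
  range (@neg_set L T U M e m).

HB.instance Definition _ L T U M e m :=
  isSubBaseTopological.Build (@type_space L T U M e m)
    (@neg_sets L T U M e m) id.

Definition Borel (X : topologicalType) : set (set X) := <<s @open X >>.

Definition has_IP (L : language) (T : theory L) (n m : nat)
    (phi : pform L ('I_n + 'I_m)) : Prop :=
  exists psi : pform L ('I_n + 'I_m),
    (forall (A : structure L) (a : 'I_n -> A) (b : 'I_m -> A),
       models A T -> ~ (sat phi (vjoin a b) /\ sat psi (vjoin a b))) /\
    exists (A : structure L) (a : nat -> 'I_n -> A) (b : set nat -> 'I_m -> A),
      models A T /\
      forall (i : nat) (W : set nat),
        (W i -> sat phi (vjoin (a i) (b W))) /\
        (~ W i -> sat psi (vjoin (a i) (b W))).

Definition NIP (L : language) (T : theory L) : Prop :=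
  forall (n m : nat) (phi : pform L ('I_n + 'I_m)), ~ has_IP T phi.

(* phi(x; c) as a formula over U. *)
Definition inst (L : language) (X Y U : Type) (phi : pform L (X + Y))
    (c : Y -> U) : pform L (X + U) :=
  prename (fun v => match v with inl i => inl i | inr j => inr (c j) end) phi.

Definition equiv_over (L : language) (U : structure L) (B : Type) (e : B -> U)
    (m : nat) (a a' : 'I_m -> U) : Prop :=
  forall phi : pform L ('I_m + B), sat phi (vjoin a e) <-> sat phi (vjoin a' e).

Definition invariant_over (L : language) (U : structure L) (B : Type)
    (e : B -> U) (n : nat) (p : set (pform L ('I_n + U))) : Prop :=
  forall (m : nat) (phi : pform L ('I_n + 'I_m)) (a a' : 'I_m -> U),
    equiv_over e a a' -> (p (inst phi a) <-> p (inst phi a')).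

Definition realizes (L : language) (U : structure L) (B V : Type) (e : B -> U)
    (c : V -> U) (q : set (pform L (V + B))) : Prop :=
  forall phi, q phi -> sat phi (vjoin c e).

(* The set d_p phi of the types over M of those c with phi(x; c) in p. *)
Definition def_set (L : language) (T : theory L) (U M : structure L)
    (e : M -> U) (n m : nat) (p : set (pform L ('I_n + U)))
    (phi : pform L ('I_n + 'I_m)) : set (type_space T e m) :=
  [set q | exists2 c : 'I_m -> U, realizes e c (sval q) & p (inst phi c)].

(* Main.v *)
Require Import Defs.
From mathcomp Require Import all_boot.
From mathcomp Require Import all_classical.
From mathcomp Require Import topology measure.
From mathcomp Require Import zify.

Set Implicit Arguments.
Unset Strict Implicit.
Unset Printing Implicit Defensive.

Local Open Scope classical_set_scope.
Local Open Scope card_scope.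
Local Notation eval := Defs.eval.

(** Why invariant types are Borel-definable.

    Fix an invariant global type [p]. It is the type of a tuple [al] in a model
    [N] into which the monster model [U] maps by [h]; so [phi(x; c)] belongs to
    [p] when [phi] holds of [al] and [h c] in [N]. A Morley sequence of [p] over
    [M] is built by realizing [p] in [U] over [M] and the earlier terms, and by
    invariance all Morley sequences of the same length have the same type over
    [M] ([morley_same_type]).

    Let [psi(x; y)] be incompatible with [phi(x; y)] modulo [T], and look at the
    Morley sequences along which [phi(x; c)] and [psi(x; c)] hold alternately.
    Their length is bounded ([alternates_bounded]): a long one contains, for
    each set [W] of indices, a subsequence on which [c] cuts out [W] by [phi]
    against [psi]; all these subsequences have the same type, so a single
    sequence is shattered, and compactness produces the independence property.
    Hence, if [phi(x; c)] is in [p], there is a greatest length [k] of alternating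
    sequences which end in [phi]. No alternating sequence of length [k + 1] ends
    in [psi], as it could be followed by one more term in [phi]. If [phi(x; c)] is not in [p],
    then by maximality of [p] some [psi(x; c)] with [psi] incompatible with [phi]
    is in [p], and for that [psi] every sequence which ends in [phi] is followed
    by one more term in [psi]. Therefore ([membership_by_alternation]), with [E]
    the condition that an alternating sequence of the given length exists,
      [phi(x; c)] is in [p] iff for all incompatible [psi] there is [k] such that
      [E] holds in length [k], ending in [phi], and fails in length [k + 1].
    As the language is countable, there are countably many [psi]. By saturation
    [E] says that the type of [c] contains certain formulas
    ([alternates_closed]), so that it defines a closed set of types. The set
    [d_p phi] is thus a countable intersection of countable unions of
    differences of closed sets.

    Three tools are used throughout. The first is the compactness theorem for
    h-inductive theories, proved by ultraproducts. With maximality it gives the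
    positive substitute for negation ([maximal_separated]): what fails of a tuple
    of [U], or of [al] together with [U], is refuted by a positive formula true
    of it. The second is closure of positive formulas under projection along
    arbitrary families of variables ([projection]), which lets types of infinite
    families be handled with no bookkeeping of variables. The third is a cardinal
    bound: saturation of [U] concerns small sets of formulas, and those over a
    small set of parameters form a small set because an infinite type [X] has as
    many elements as its square ([square_embeds]). *)

(** * Positive formulas: renaming, finite support, projection *)

Section Semantics.
Variable L : language.
Implicit Types (A : structure L).

Lemma eval_trename A (V W : Type) (s : V -> W) (t : term L V) (a : W -> A) :
  eval a (trename s t) = eval (a \o s) t.
Proof.
elim: t => [v|f args IH] //=.
by congr finterp; apply: funext => i; exact: IH.
Qed.

Lemma vcons_omap (B V W : Type) (x : B) (s : V -> W) (a : W -> B) :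
  vcons x a \o omap s = vcons x (a \o s).
Proof. by apply: funext => -[]. Qed.

Lemma sat_prename A (V W : Type) (s : V -> W) (phi : pform L V) (a : W -> A) :
  sat (prename s phi) a = sat phi (a \o s).
Proof.
elim: phi W s a => {V}
  [V t u|V r args|V|V|V f IHf g IHg|V f IHf g IHg|V f IHf] W s a //=.
- by rewrite !eval_trename.
- by congr rinterp; apply: funext => i; exact: eval_trename.
- by rewrite IHf IHg.
- by rewrite IHf IHg.
- by congr ex; apply: funext => x; rewrite IHf vcons_omap.
Qed.

(** Semantic rather than syntactic, since formulas only matter here through the
    sets that they define. *)
Definition supported (V : Type) (D : set V) (phi : pform L V) : Prop :=
  forall A (a b : V -> A), {in D, a =1 b} -> sat phi a -> sat phi b.

Lemma eq_in_setU (V B : Type) (D E : set V) (a b : V -> B) :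
  {in D `|` E, a =1 b} -> {in D, a =1 b} /\ {in E, a =1 b}.
Proof.
by move=> ab; split=> v; rewrite inE => Dv; apply: ab; apply/mem_set;
  [left|right].
Qed.

Lemma finite_support_eval (V : Type) (t : term L V) :
  exists2 D : set V, finite_set D &
    forall A (a b : V -> A), {in D, a =1 b} -> eval a t = eval b t.
Proof.
elim: t => [v|f args IH].
  exists [set v] => // A a b; apply; exact/mem_set.
have /choice[D HD] : forall i, exists D : set V, finite_set D /\
    forall A (a b : V -> A), {in D, a =1 b} -> eval a (args i) = eval b (args i).
  by move=> i; have [D ? ?] := IH i; exists D.
exists (\bigcup_(i in setT) D i).
  by apply: bigcup_finite => // i _; have [] := HD i.
move=> A a b ab /=; congr finterp; apply: funext => i; apply: (HD i).2 => v.
by rewrite inE => Dv; apply: ab; apply/mem_set; exists i.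
Qed.

Lemma finite_support (V : Type) (phi : pform L V) :
  exists2 D : set V, finite_set D & supported D phi.
Proof.
elim: phi => {V}
  [V t u|V r args|V|V|V f [D fD HD] g [E fE HE]|V f [D fD HD] g [E fE HE]|
   V f [D fD HD]].
- have [D fD HD] := finite_support_eval t; have [E fE HE] := finite_support_eval u.
  exists (D `|` E); first by rewrite finite_setU.
  by move=> A a b /eq_in_setU[ab ab'] /=; rewrite (HD A a b) // (HE A a b).
- have /choice[D HD] : forall i, exists D : set V, finite_set D /\
    forall A (a b : V -> A), {in D, a =1 b} -> eval a (args i) = eval b (args i).
    by move=> i; have [D ? ?] := finite_support_eval (args i); exists D.
  exists (\bigcup_(i in setT) D i).
    by apply: bigcup_finite => // i _; have [] := HD i.
  move=> A a b ab /=; rewrite (_ : (fun i => eval a _) = fun i => eval b (args i)) //.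
  apply: funext => i; apply: (HD i).2 => v.
  by rewrite inE => Dv; apply: ab; apply/mem_set; exists i.
- by exists set0.
- by exists set0.
- exists (D `|` E); first by rewrite finite_setU.
  move=> A a b /eq_in_setU[ab ab'] /= [fa ga].
  by split; [exact: HD fa|exact: HE ga].
- exists (D `|` E); first by rewrite finite_setU.
  move=> A a b /eq_in_setU[ab ab'] /= [fa|ga].
    by left; exact: HD fa.
  by right; exact: HE ga.
- exists (Some @^-1` D).
    by apply: finite_preimage => // x y _ _ [].
  move=> A a b ab /= [x fx]; exists x; apply: HD fx => -[v|//].
  by rewrite inE => Dv /=; apply: ab; apply/mem_set.
Qed.

(** This reduces formulas in arbitrary families of variables to those of the
    definitions of homomorphisms, invariance and models, which have finitely
    many. *)
Lemma finite_variables (V : Type) (phi : pform L V) :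
  exists (r : nat) (s : 'I_r -> V) (phi' : pform L 'I_r),
    forall A (a : V -> A), sat phi a <-> sat phi' (a \o s).
Proof.
have [D fD HD] := finite_support phi.
have [[v0]|nV] := pselect (inhabited V); last first.
  pose g (v : V) : 'I_0 := False_rect _ (nV (inhabits v)).
  pose s (i : 'I_0) : V := False_rect _ (notF (ltn_ord i)).
  exists 0, s, (prename g phi) => A a; rewrite sat_prename.
  rewrite (_ : (a \o s) \o g = a) //.
  by apply: funext => v; case: (nV (inhabits v)).
have [l Dl] := (@finite_seqP {classic V} _).1 fD.
pose s (i : 'I_(size l).+1) : V := nth v0 l i.
pose g (v : V) : 'I_(size l).+1 := inord (@index {classic V} v l).
exists (size l).+1, s, (prename g phi) => A a; rewrite sat_prename.
have E : {in D, (a \o s) \o g =1 a}.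
  move=> v; rewrite inE Dl /= => vl.
  by rewrite /s /g inordK ?(@nth_index {classic V}) // ltnS index_size.
by split; apply: HD => v Dv; rewrite E.
Qed.


Lemma finite_conj (V : Type) (S : set (pform L V)) : finite_set S ->
  exists chi : pform L V,
    forall A (a : V -> A), sat chi a <-> forall phi, S phi -> sat phi a.
Proof.
move=> /(@finite_seqP {classic pform L V})[l ->].
elim: l => [|f l [chi IH]]; first by exists (PTop L V).
exists (PAnd f chi) => A a /=; rewrite IH; split.
  by move=> [fa la] g /=; rewrite inE => /orP[/eqP->//|]; exact: la.
move=> H; split; first by apply: H; rewrite /= inE eqxx.
by move=> g gl; apply: H; rewrite /= inE gl orbT.
Qed.

Lemma projection_list (V W : Type) (phi : pform L (V + W)) (l : seq {classic W}) :
  exists psi : pform L (V + W), forall A (a : V -> A) (b : W -> A),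
    sat psi (vjoin a b) <->
    exists b' : W -> A, (forall w, w \notin l -> b' w = b w) /\
      sat phi (vjoin a b').
Proof.
elim: l => [|w l [psi IH]].
  exists phi => A a b; split=> [phib|[b' [b'b phib']]]; first by exists b.
  by have <- : b' = b by apply: funext => w; exact: b'b.
pose s (v : V + W) : option (V + W) := match v with
  | inl v => Some (inl v)
  | inr w' => if pselect (w' = w) then None else Some (inr w') end.
exists (PEx (prename s psi)) => A a b /=.
have E x : vcons x (vjoin a b) \o s =
    vjoin a (fun w' => if pselect (w' = w) then x else b w').
  by apply: funext => -[//|w' /=]; case: pselect.
split=> [[x]|[b' [b'b phib']]].
  rewrite sat_prename E => /IH[b' [b'b phib']]; exists b'; split=> // w'.
  rewrite inE negb_or => /andP[/eqP w'w /b'b ->].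
  by case: pselect.
exists (b' w); rewrite sat_prename E; apply/IH; exists b'; split=> // w' w'l.
case: pselect => [e|w'w] /=; first by rewrite e.
apply: b'b.
by rewrite inE negb_or w'l andbT; exact/eqP.
Qed.

(** The quantified family [W] may be infinite, because only finitely many of its
    variables matter. *)
Lemma projection (V W : Type) (phi : pform L (V + W)) :
  exists psi : pform L V, forall A (a : V -> A),
    sat psi a <-> exists b : W -> A, sat phi (vjoin a b).
Proof.
have [D fD HD] := finite_support phi.
have : finite_set (inr @^-1` D : set W).
  by apply: finite_preimage => // x y _ _ [].
move=> /(@finite_seqP {classic W})[l Dl].
have [psi Hpsi] := projection_list phi l.
(* One dummy value stands for all the variables outside of the support. *)
pose s (v : V + W) : option V := if v is inl v then Some v else None.
exists (PEx (prename s psi)) => A a /=.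
have E x : vcons x a \o s = vjoin a (fun=> x) by apply: funext => -[].
split=> [[x]|[b phib]].
  by rewrite sat_prename E => /Hpsi[b' [_ ?]]; exists b'.
have [x] := carrier_inhabited A; exists x; rewrite sat_prename E; apply/Hpsi.
exists (fun w => if (w : {classic W}) \in l then b w else x).
split=> [w /negbTE -> //|]; apply: HD phib => -[v//|w] /set_mem Dw /=.
by have -> : (w : {classic W}) \in l by move: Dw; rewrite -[D _]/((inr @^-1` D) w) Dl.
Qed.

End Semantics.

(** * Ultraproducts and compactness *)

Lemma cid_eq (B : Type) (P Q : B -> Prop) (p : ex P) (q : ex Q) :
  P = Q -> sval (cid p) = sval (cid q).
Proof. by move=> e; subst Q; rewrite (Prop_irrelevance p q). Qed.

Lemma dep_choice (I : Type) (B : I -> Type) (P : forall i, B i -> Prop) :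
  (forall i, exists x, P i x) -> exists f : forall i, B i, forall i, P i (f i).
Proof.
by move=> H; exists (fun i => sval (cid (H i))) => i; case: cid.
Qed.

Section Ultraproduct.
Variables (L : language) (I : Type) (F : set_system I) (FU : UltraFilter F).
Variable (A : I -> structure L).

Local Notation fam := (forall i, A i).

Definition ae_eq (f g : fam) : Prop := F [set i | f i = g i].

Lemma ae_eq_sym f g : ae_eq f g -> ae_eq g f.
Proof. by apply: filterS => i /=. Qed.

Lemma ae_eq_trans f g h : ae_eq f g -> ae_eq g h -> ae_eq f h.
Proof. by apply: filterS2 => i /= -> ->. Qed.

(** The points of the ultraproduct are chosen representatives of the classes of
    [ae_eq], so that equality of points is equality almost everywhere. *)
Definition ae_repr (f : fam) : fam :=
  sval (cid (ex_intro (ae_eq f) f (filterS (fun i _ => erefl (f i)) filterT))).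

Lemma ae_reprP f : ae_eq f (ae_repr f).
Proof. by rewrite /ae_repr; case: cid. Qed.

Lemma ae_repr_eq f g : ae_eq f g -> ae_repr f = ae_repr g.
Proof.
move=> fg; apply: cid_eq; apply: funext => h; apply: propext; split=> H.
  exact: ae_eq_trans (ae_eq_sym fg) H.
exact: ae_eq_trans fg H.
Qed.

Definition ultracarrier : Type := {f : fam | ae_repr f = f}.

Definition ultraclass (f : fam) : ultracarrier :=
  exist _ (ae_repr f) (esym (ae_repr_eq (ae_reprP f))).

Lemma ultraclassP f : F [set i | sval (ultraclass f) i = f i].
Proof. exact: ae_eq_sym (ae_reprP f). Qed.

Lemma ultracarrier_eq (x y : ultracarrier) :
  ae_eq (sval x) (sval y) -> x = y.
Proof.
case: x y => [f fE] [g gE] /= fg; apply: eq_exist.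
by rewrite -fE -gE; exact: ae_repr_eq.
Qed.

Lemma ultracarrier_inhabited : inhabited ultracarrier.
Proof.
have /dep_choice[f _] : forall i, exists x : A i, True.
  by move=> i; have [x] := carrier_inhabited (A i); exists x.
exact: inhabits (ultraclass f).
Qed.

Definition ultraproduct : structure L := @Structure L ultracarrier
  ultracarrier_inhabited
  (fun f args => ultraclass (fun i => finterp (fun j => sval (args j) i)))
  (fun r args => F [set i | rinterp (fun j => sval (args j) i)]).

Lemma ultraproduct_eval (V : Type) (t : term L V) (a : V -> ultraproduct) :
  F [set i | sval (eval a t) i = eval (fun v => sval (a v) i) t].
Proof.
elim: t => [v|f args IH] /=; first exact: filterS filterT.
have H : F [set i | forall j, sval (eval a (args j)) i =
    eval (fun v => sval (a v) i) (args j)] by exact: filter_forall.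
have E := ultraclassP (fun i => finterp (fun j => sval (eval a (args j)) i)).
apply: filterS2 E H => i /= -> H.
by congr finterp; apply: funext => j; exact: H.
Qed.

(** As formulas are positive, only disjunction needs the filter to be ultra. *)
Theorem Los (V : Type) (phi : pform L V) (a : V -> ultraproduct) :
  sat phi a <-> F [set i | sat phi (fun v => sval (a v) i)].
Proof.
elim: phi a => {V}
  [V t u|V r args|V|V|V f IHf g IHg|V f IHf g IHg|V f IHf] a /=.
- have Ht := ultraproduct_eval t a; have Hu := ultraproduct_eval u a; split.
    by move=> tu; move: Ht Hu; rewrite tu; apply: filterS2 => i /= <- <-.
  move=> H; apply: ultracarrier_eq; rewrite /ae_eq.
  by apply: filterS2 H (filterI Ht Hu) => i /= H [-> ->].
- have H : F [set i | forall j, sval (eval a (args j)) i =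
      eval (fun v => sval (a v) i) (args j)].
    by apply: filter_forall => j; exact: ultraproduct_eval.
  by split; apply: filterS2 H => i /= /funext ->.
- by split=> // _; exact: filterT.
- by split=> // /filter_ex[].
- rewrite IHf IHg; split=> [[]|H]; first by apply: filterS2.
  by split; apply: filterS H => i [].
- rewrite IHf IHg; split=> [[]|H].
  + by apply: filterS => i; left.
  + by apply: filterS => i; right.
  have [|H'] := in_ultra_setVsetC [set i | sat f (fun v => sval (a v) i)] FU.
    by left.
  by right; apply: filterS2 H H' => i [].
- have E (x : ultraproduct) i : (fun v => sval (vcons x a v) i) =
      vcons (sval x i) (fun v => sval (a v) i) by apply: funext => -[].
  split=> [[x /IHf]|H].
    by apply: filterS => i /=; rewrite E; exists (sval x i).
  have /dep_choice[g Hg] : forall i, exists x : A i,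
      (exists y, sat f (vcons y (fun v => sval (a v) i))) ->
      sat f (vcons x (fun v => sval (a v) i)).
    move=> i; have [[y Hy]|N] := pselect (exists y : A i,
      sat f (vcons y (fun v => sval (a v) i))); first by exists y.
    by have [x] := carrier_inhabited (A i); exists x.
  exists (ultraclass g); apply/IHf.
  apply: filterS2 H (ultraclassP g) => i; rewrite /mkset E => Hi ->.
  exact: Hg.
Qed.

Lemma ultraproduct_models (T : theory L) :
  (forall i, models (A i) T) -> models ultraproduct T.
Proof.
by move=> AT s Ts a /Los H; apply/Los; apply: filterS H => i; exact: AT.
Qed.

End Ultraproduct.

(** The ultraproduct is taken over the finite subsets of [S], along an
    ultrafilter that contains the cone above each of them. *)
Theorem compactness (L : language) (T : theory L) (V : Type)
    (S : set (pform L V)) :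
  (forall S0, S0 `<=` S -> finite_set S0 ->
    exists (A : structure L) (a : V -> A),
      models A T /\ forall phi, S0 phi -> sat phi a) ->
  exists (A : structure L) (a : V -> A),
    models A T /\ forall phi, S phi -> sat phi a.
Proof.
move=> fS.
pose I := {S0 : set (pform L V) | S0 `<=` S /\ finite_set S0}.
have /choice[A /dep_choice[a Aa]] : forall i : I, exists A : structure L,
    exists a : V -> A, models A T /\ forall phi, sval i phi -> sat phi a.
  by case=> S0 [S0S finS0]; exact: fS.
pose G : set_system I := filter_from setT
  (fun i : I => [set j : I | sval i `<=` sval j]).
have GP : ProperFilter G.
  apply: filter_from_proper => [|i _]; last by exists i => /=.
  apply: filter_from_filter; first by exists (exist _ set0 (conj (sub0set _) (finite_set0 _))).
  move=> [S1 [S1S fin1]] [S2 [S2S fin2]] _ _.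
  have S12 : S1 `|` S2 `<=` S /\ finite_set (S1 `|` S2).
    by split; [rewrite subUset|rewrite finite_setU].
  exists (exist _ (S1 `|` S2) S12 : I) => // -[S3 S3P] /=.
  by rewrite subUset => -[].
have [F [FU GF]] := ultraFilterLemma GP.
pose b (v : V) := ultraclass FU (fun i => a i v).
exists (ultraproduct FU A), b; split.
  by apply: ultraproduct_models => i; have [] := Aa i.
move=> phi Sphi; have [D fD HD] := finite_support phi.
have H1 : F [set i | {in D, forall v, sval (b v) i = a i v}].
  have /(@finite_seqP {classic V})[l ->] := fD.
  elim: l => [|v l IH]; first by apply: filterS filterT => i _ v; rewrite inE.
  apply: filterS2 IH (ultraclassP FU (fun i => a i v)) => i /= IH bv w.
  by rewrite inE /= inE => /orP[/eqP->//|wl]; apply: IH; rewrite inE.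
have S1 : [set phi] `<=` S /\ finite_set [set phi].
  by split; [move=> _ ->|exact: finite_set1].
have H2 : F [set i | sval i phi].
  by apply: GF; exists (exist _ [set phi] S1 : I) => // i /= /(_ _ erefl).
apply/Los; apply: filterS2 H1 H2 => i /= H1 H2.
have := (Aa i).2 _ H2; apply: HD => v Dv; exact/esym/H1.
Qed.

(** * Infinite types and their squares *)

Definition embeds (A B : Type) : Prop := exists f : A -> B, injective f.

Lemma embeds_trans (A B C : Type) : embeds A B -> embeds B C -> embeds A C.
Proof. by move=> [f fI] [g gI]; exists (g \o f); exact: inj_comp. Qed.

(** A maximal graph of a partial injection is total on one of the two sides. *)
Lemma embeds_total (A B : Type) : embeds A B \/ embeds B A.
Proof.
pose P (G : set (A * B)) := forall a b a' b', G (a, b) -> G (a', b') ->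
  a = a' <-> b = b'.
have [F FP tot|G [PG maxG]] := @Zorn_bigcup _ P.
  move=> a b a' b' [G FG Gab] [G' FG' Gab'].
  have [GG'|G'G] := tot _ _ FG FG'.
    by apply: (FP _ FG') => //; exact: GG'.
  by apply: (FP _ FG) => //; exact: G'G.
have [/choice[f Hf]|/existsNP[a na]] := pselect (forall a, exists b, G (a, b)).
  by left; exists f => a a' E; apply/(PG _ _ _ _ (Hf a) (Hf a')).
have [/choice[f Hf]|/existsNP[b nb]] := pselect (forall b, exists a, G (a, b)).
  by right; exists f => b b' E; apply/(PG _ _ _ _ (Hf b) (Hf b')).
exfalso; apply: (maxG (G `|` [set (a, b)])).
  split=> [t|/(_ (a, b)) H]; first by left.
  by apply: na; exists b; apply: H; right.
move=> a1 b1 a2 b2 [G1|[-> ->]] [G2|[-> ->]] //; first exact: PG.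
  by split=> E; [case: na; exists b1; rewrite -E|case: nb; exists a1; rewrite -E].
by split=> E; [case: na; exists b2; rewrite E|case: nb; exists a2; rewrite E].
Qed.

Section Square.
Variable X : Type.

Definition pairing_graph (A : Type) (e : A -> X) (pr : A -> A -> A) :
    set (X * X * X) :=
  [set t | exists a b, t = (e a, e b, e (pr a b))].

Definition square_dom (H : set (X * X * X)) : set X :=
  [set x | exists z, H (x, x, z)].

(** [H] is the graph of an injection from the square of [square_dom H] to
    [square_dom H]. *)
Definition is_pairing (H : set (X * X * X)) : Prop :=
  [/\ forall x y x' y' z z', H (x, y, z) -> H (x', y', z') ->
        (x = x' /\ y = y') <-> z = z',
      forall x y z, H (x, y, z) ->
        [/\ square_dom H x, square_dom H y & square_dom H z]
    & forall x y, square_dom H x -> square_dom H y -> exists z, H (x, y, z)].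

Definition inj2 (A B C : Type) (f : A -> B -> C) : Prop :=
  forall a b a' b', f a b = f a' b' -> a = a' /\ b = b'.

Lemma pairing_graphP (A : Type) (e : A -> X) (pr : A -> A -> A) :
  injective e -> inj2 pr -> is_pairing (pairing_graph e pr).
Proof.
move=> eI prI.
have dom a : square_dom (pairing_graph e pr) (e a).
  by exists (e (pr a a)), a, a.
split=> [_ _ _ _ _ _ [a [b [-> -> ->]]] [a' [b' [-> -> ->]]]|
         _ _ _ [a [b [-> -> ->]]]|
         x y [z [a [b [-> _ _]]]] [z' [a' [b' [-> _ _]]]]].
- split=> [[/eI -> /eI ->] //|/eI/prI[-> ->] //].
- by split; exact: dom.
- by exists (e (pr a a')), a, a'.
Qed.

Lemma is_pairingP (H : set (X * X * X)) : is_pairing H ->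
  exists pr : sig (square_dom H) -> sig (square_dom H) -> sig (square_dom H),
    inj2 pr /\ H = pairing_graph sval pr.
Proof.
move=> [fnI closedH totH].
have /choice[pr Hpr] : forall ab : sig (square_dom H) * sig (square_dom H),
    exists c : sig (square_dom H), H (sval ab.1, sval ab.2, sval c).
  move=> [[x Dx] [y Dy]]; have [z Hz] := totH _ _ Dx Dy.
  by have [_ _ Dz] := closedH _ _ _ Hz; exists (exist _ z Dz).
exists (fun a b => pr (a, b)); split=> [a b a' b' E|].
  have [_ []] := fnI _ _ _ _ _ _ (Hpr (a, b)) (Hpr (a', b')).
    by rewrite E.
  by move=> /= aa' bb'; split; exact: eq_sig_hprop.
apply/seteqP; split=> [[[x y] z] Hxyz|_ [a [b ->]]]; last exact: (Hpr (a, b)).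
have [Dx Dy _] := closedH _ _ _ Hxyz.
exists (exist _ x Dx), (exist _ y Dy).
by rewrite -((fnI _ _ _ _ _ _ Hxyz (Hpr (exist _ x Dx, exist _ y Dy))).1 _).
Qed.

(** Pairing on two copies of [A]: the three new quarters of the square are
    sent to the second copy, tagged by [c] to keep them apart. *)
Definition double_pairing (A : Type) (pr : A -> A -> A) (c : bool * bool -> A)
    (u v : bool * A) : bool * A :=
  if u.1 || v.1 then (true, pr (c (u.1, v.1)) (pr u.2 v.2))
  else (false, pr u.2 v.2).

Lemma double_pairing_inj (A : Type) (pr : A -> A -> A) (c : bool * bool -> A) :
  inj2 pr -> injective c -> inj2 (double_pairing pr c).
Proof.
move=> prI cI [s a] [t b] [s' a'] [t' b']; rewrite /double_pairing /=.
case: ifP => st; case: ifP => st' // [].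
  by move=> /prI[/cI[-> ->] /prI[-> ->]].
by move: st st' => /norP[/negbTE-> /negbTE->] /norP[/negbTE-> /negbTE->] /prI[-> ->].
Qed.

(** Zorn's lemma gives a maximal subset [A] of [X] with an injection of its
    square into itself; [A] contains a copy of [nat] by construction. If the
    complement of [A] contains a copy of [A], then [double_pairing] contradicts
    maximality; otherwise [X] embeds in two copies of [A], hence in [A]. *)
Theorem square_embeds : embeds nat X -> exists pr : X -> X -> X, inj2 pr.
Proof.
move=> [k kI].
have cantorI : inj2 (fun i j : nat => pickle (i, j)).
  by move=> i j i' j' /(pcan_inj pickleK)[].
pose G0 := pairing_graph k (fun i j => pickle (i, j)).
pose P (G : set (X * X * X)) := is_pairing (G `|` G0).
have [F FP tot|G [PG maxG]] := @Zorn_bigcup _ P.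
  have P0 : P set0 by rewrite /P set0U; exact: pairing_graphP.
  have sub G : P G -> (G = set0 \/ F G) ->
      G `|` G0 `<=` (\bigcup_(G in F) G) `|` G0.
    by move=> _ [->|FG]; apply: setSU => // t Gt; exists G.
  have two t t' : ((\bigcup_(G in F) G) `|` G0) t ->
      ((\bigcup_(G in F) G) `|` G0) t' ->
      exists G, [/\ P G, G = set0 \/ F G, (G `|` G0) t & (G `|` G0) t'].
    move=> [[G FG Gt]|G0t] [[G' FG' Gt']|G0t'].
    - have [GG'|G'G] := tot _ _ FG FG'.
        exists G'; split; [exact: FP|by right|left; exact: GG'|by left].
      exists G; split; [exact: FP|by right|by left|left; exact: G'G].
    - by exists G; split; [exact: FP|right|left|right].
    - by exists G'; split; [exact: FP|right|right|left].
    - by exists set0; split; [|left|right|right].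
  split=> [x y x' y' z z' H H'|x y z H|x y [z H] [z' H']].
  - have [G [[fnI _ _] _ Gt Gt']] := two _ _ H H'.
    exact: fnI Gt Gt'.
  - have [G [PG FG Gt _]] := two _ _ H H.
    have [_ closed _] := PG; have [[x1 ?] [y1 ?] [z1 ?]] := closed _ _ _ Gt.
    by split; [exists x1|exists y1|exists z1]; exact: sub PG FG _ _.
  - have [G [PG FG Gt Gt']] := two _ _ H H'.
    have [_ _ tt] := PG; have [z1 ?] := tt x y (ex_intro _ z Gt) (ex_intro _ z' Gt').
    by exists z1; exact: sub PG FG _ _.
have [pr [prI Hpr]] := is_pairingP PG.
pose A := sig (square_dom (G `|` G0)).
have kD i : square_dom (G `|` G0) (k i).
  by exists (k (pickle (i, i))); right; exists i, i.
pose kA i : A := exist _ (k i) (kD i).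
have kAI : injective kA by move=> i j [/kI].
pose c (st : bool * bool) : A := kA (pickle st).
have cI : injective c by move=> u v /kAI /(pcan_inj pickleK).
have [[f fI]|[f fI]] := embeds_total {x | ~ square_dom (G `|` G0) x} A; last first.
  pose e (u : bool * A) : X := if u.1 then sval (f u.2) else sval u.2.
  have eI : injective e.
    move=> [[] [a Da]] [[] [b Db]] //=; rewrite /e /=.
    - by move=> E; congr pair; apply: fI; exact: eq_sig_hprop.
    - by case: (f _) => x nDx /= E; case: nDx; rewrite E.
    - by case: (f _) => x nDx /= E; case: nDx; rewrite -E.
    - by move=> E; congr pair; exact: eq_sig_hprop.
  pose H := pairing_graph e (double_pairing pr c).
  have GH : G `|` G0 `<=` H.
    by rewrite Hpr => _ [a [b ->]]; exists (false, a), (false, b).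
  exfalso; apply: (maxG H).
    split=> [t Gt|HG]; first by apply: GH; left.
    have : (G `|` G0) (e (true, kA 0), e (true, kA 0),
        e (double_pairing pr c (true, kA 0) (true, kA 0))).
      by left; apply: HG; exists (true, kA 0), (true, kA 0).
    by rewrite /e /=; case: (f _) => x nDx /= Gx; apply: nDx; eexists; exact: Gx.
  rewrite /P (_ : H `|` G0 = H).
    by apply: pairing_graphP => //; exact: double_pairing_inj.
  by apply/setUidPl => t G0t; apply: GH; right.
pose j (x : X) : A := match pselect (square_dom (G `|` G0) x) with
  | left Dx => pr (c (false, false)) (exist _ x Dx)
  | right nDx => pr (c (true, true)) (f (exist _ x nDx)) end.
have jI : injective j.
  move=> x y; rewrite /j; case: pselect => Dx; case: pselect => Dy /prI[/cI //].
    by move=> _ [].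
  by move=> _ /fI[].
exists (fun x y => sval (pr (j x) (j y))) => x y x' y' E.
have /prI[/jI -> /jI ->] // : pr (j x) (j y) = pr (j x') (j y').
exact: eq_sig_hprop.
Qed.

End Square.

(** * The number of formulas *)

Section Coding.
Variables (L : language) (X : Type) (k : nat -> X) (pr : X -> X -> X).
Hypotheses (L_countable : countable_language L) (kI : injective k)
  (prI : inj2 pr).

Lemma tuple_code r : exists g : ('I_r -> X) -> X, injective g.
Proof.
elim: r => [|r [g gI]].
  by exists (fun=> k 0) => c c' _; apply: funext => -[].
exists (fun c => pr (c ord0) (g (fun i => c (lift ord0 i)))).
move=> c c' /prI[c0 /gI cl]; apply: funext => i.
case: (unliftP ord0 i) => [j ->|->//].
exact: (congr1 (fun c => c j) cl).
Qed.

Definition tagged_code (n : nat) (x : X) : X := pr (k n) x.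

Lemma tagged_codeE n x n' x' :
  tagged_code n x = tagged_code n' x' -> n = n' /\ x = x'.
Proof. by move=> /prI[/kI -> ->]. Qed.

Lemma countable_code (A : Type) : countable [set: A] -> exists f : A -> nat, injective f.
Proof.
by move=> /countable_injP[f fI]; exists f => x y; apply: fI; rewrite inE.
Qed.

Lemma term_code (V : Type) (i : V -> X) : injective i ->
  exists f : term L V -> X, injective f.
Proof.
move=> iI; have [fc fcI] := countable_code L_countable.1.
have /dep_choice[g gI] := tuple_code.
pose code := fix code (t : term L V) : X := match t with
  | Var v => tagged_code 0 (i v)
  | App f args => tagged_code 1
      (tagged_code (fc f) (g (farity f) (fun j => code (args j)))) end.
exists code; elim=> [v|f args IH] [v'|f' args'] /= /tagged_codeE[] //.
  by move=> _ /iI ->.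
move=> _ /tagged_codeE[/fcI ff']; subst f' => /gI E; congr App.
apply: funext => j; apply: IH; exact: (congr1 (fun c => c j) E).
Qed.

(** Formulas are coded as trees; below a quantifier the coding of variables is
    extended to the new one, so the recursion is uniform in it. *)
Lemma pform_code (V : Type) : embeds V X -> embeds (pform L V) X.
Proof.
have [rc rcI] := countable_code L_countable.2.
have /dep_choice[g gI] := tuple_code.
have H : forall V : Type, exists tc : (V -> X) -> term L V -> X,
    forall i, injective i -> injective (tc i).
  move=> W; apply: (@dep_choice (W -> X) (fun=> term L W -> X)
    (fun i f => injective i -> injective f)) => i.
  have [/term_code[f fI]|ni] := pselect (injective i); first by exists f.
  by exists (fun=> k 0).
have [tc tcI] := dep_choice H.
pose oc (W : Type) (i : W -> X) (w : option W) : X :=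
  if w is Some w then tagged_code 1 (i w) else tagged_code 0 (k 0).
have ocI W (i : W -> X) : injective i -> injective (oc W i).
  by move=> iI [x|] [y|] //= /tagged_codeE[] // _ /iI ->.
pose code := fix code (W : Type) (phi : pform L W) : (W -> X) -> X :=
  match phi with
  | PEq t u => fun i => tagged_code 0 (pr (tc _ i t) (tc _ i u))
  | PRel r args => fun i => tagged_code 1 (tagged_code (rc r)
      (g (rarity r) (fun j => tc _ i (args j))))
  | PTop => fun i => tagged_code 2 (k 0)
  | PBot => fun i => tagged_code 3 (k 0)
  | PAnd f g => fun i => tagged_code 4 (pr (code _ f i) (code _ g i))
  | POr f g => fun i => tagged_code 5 (pr (code _ f i) (code _ g i))
  | PEx f => fun i => tagged_code 6 (code _ f (oc _ i)) end.
have codeI : forall W (phi psi : pform L W) (i : W -> X), injective i ->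
    code W phi i = code W psi i -> phi = psi.
  move=> W; elim=> {W} [W t u|W r args|W|W|W f IHf h IHh|W f IHf h IHh|W f IHf]
    [t' u'|r' args'|||f' h'|f' h'|f'] i iI /= /tagged_codeE[] //.
  - by move=> _ /prI[/(tcI _ _ iI)-> /(tcI _ _ iI)->].
  - move=> _ /tagged_codeE[/rcI rr']; subst r' => /gI E; congr PRel.
    apply: funext => j; apply: (tcI _ _ iI); exact: (congr1 (fun c => c j) E).
  - by move=> _ /prI[/(IHf _ _ iI)-> /(IHh _ _ iI)->].
  - by move=> _ /prI[/(IHf _ _ iI)-> /(IHh _ _ iI)->].
  - by move=> _ /(IHf _ _ (ocI _ _ iI))->.
by move=> [i iI]; exists (fun phi => code V phi i) => phi psi; exact: codeI.
Qed.

End Coding.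

Lemma embeds_card (A B : Type) : embeds A B -> [set: A] #<= [set: B].
Proof.
move=> [f fI]; have [g] : $|{injfun [set: A] >-> [set: B]}|.
  by apply/injfunPex; exists f => // x y _ _; exact: fI.
exact: inj_card_le g.
Qed.

Lemma card_embeds (A B : Type) : [set: A] #<= [set: B] -> embeds A B.
Proof.
move=> /card_leP[f].
exists (fun x => val (f (SigSub (mem_set (I : [set: A] x))))) => x y /val_inj E.
have := @inj _ _ _ f _ _ (mem_set I) (mem_set I) E.
by move=> [].
Qed.

Lemma card_lt_le (A B C : Type) (SA : set A) (SB : set B) (SC : set C) :
  SA #<= SB -> card_lt SB SC -> card_lt SA SC.
Proof.
move=> AB [BC nCB]; split; first exact: card_le_trans AB BC.
by move=> CA; apply: nCB; exact: card_le_trans CA AB.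
Qed.

(** If [M] is finite, [nat] will do; otherwise [M] itself does, by
    [square_embeds]. *)
Lemma small_pairing_type (K M : Type) : card_lt [set: nat] [set: K] ->
  small K [set: M] ->
  exists X : Type, [/\ small K [set: X], embeds nat X, embeds M X
    & exists pr : X -> X -> X, inj2 pr].
Proof.
move=> natK MK.
have [finM|/infiniteP/card_embeds natM] := pselect (finite_set [set: M]).
  exists nat; split=> //; first by exists id.
    exact/card_embeds/finite_set_countable.
  by apply: square_embeds; exists id.
by exists M; split=> //; [exists id|exact: square_embeds].
Qed.

(** * Types and their separation by positive formulas *)

Lemma vjoin_comp (A B V W : Type) (f : A -> B) (a : V -> A) (b : W -> A) :
  f \o vjoin a b = vjoin (f \o a) (f \o b).
Proof. by apply: funext => -[]. Qed.

Lemma vjoinK (A V W : Type) (a : V + W -> A) : vjoin (a \o inl) (a \o inr) = a.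
Proof. by apply: funext => -[]. Qed.

Section Types.
Variables (L : language) (T : theory L).
Implicit Types A B N : structure L.

Definition same_type A B (V : Type) (a : V -> A) (b : V -> B) : Prop :=
  forall phi : pform L V, sat phi a <-> sat phi b.

Lemma same_type_sym A B (V : Type) (a : V -> A) (b : V -> B) :
  same_type a b -> same_type b a.
Proof. by move=> ab phi; rewrite ab. Qed.

Lemma same_type_trans A B N (V : Type) (a : V -> A) (b : V -> B) (c : V -> N) :
  same_type a b -> same_type b c -> same_type a c.
Proof. by move=> ab bc phi; rewrite ab. Qed.

Lemma same_type_reindex A B (V W : Type) (s : W -> V) (a : V -> A) (b : V -> B) :
  same_type a b -> same_type (a \o s) (b \o s).
Proof. by move=> ab phi; have := ab (prename s phi); rewrite !sat_prename. Qed.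

Lemma homomorphism_sat A B (f : A -> B) (V : Type) (phi : pform L V)
    (a : V -> A) : homomorphism f -> sat phi a -> sat phi (f \o a).
Proof.
move=> fhom; have [r [s [phi' E]]] := finite_variables phi.
by move=> /E/fhom H; apply/E.
Qed.

Lemma immersion_same_type A B (f : A -> B) (V : Type) (a : V -> A) :
  immersion f -> same_type a (f \o a).
Proof.
move=> [fhom fimm] phi; split; first exact: homomorphism_sat.
have [r [s [phi' E]]] := finite_variables phi.
by move=> /E/fimm H; apply/E.
Qed.

Definition incompatible (V : Type) (phi psi : pform L V) : Prop :=
  forall A (a : V -> A), models A T -> ~ (sat phi a /\ sat psi a).

(** The failure of a formula is witnessed by a positive formula, as for tuples
    of pec models. *)
Definition separated A (V : Type) (a : V -> A) : Prop :=
  forall phi : pform L V, ~ sat phi a ->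
    exists2 psi : pform L V, sat psi a & incompatible phi psi.

(** Otherwise compactness would give a realization of the type of [a] which
    also satisfies [phi]. *)
Lemma maximal_separated A (V : Type) (a : V -> A) :
  (forall B (b : V -> B), models B T ->
     (forall phi, sat phi a -> sat phi b) ->
     forall phi, sat phi b -> sat phi a) ->
  separated a.
Proof.
move=> amax phi nphi; apply: contrapT => npsi; apply: nphi.
pose S := [set psi | sat psi a] `|` [set phi].
have [S0 S0S finS0|B [b [BT bS]]] := @compactness L T V S; last first.
  by apply: (amax B b BT) => [psi apsi|]; apply: bS; [left|right].
have [chi Hchi] := finite_conj (finite_setD [set phi] finS0).
have chia : sat chi a.
  by apply/Hchi => psi [/S0S[//|/= ->]].
have [B [b [BT [phib chib]]]] : exists B (b : V -> B),
    models B T /\ (sat phi b /\ sat chi b).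
  apply: contrapT => H; apply: npsi; exists chi => // B b BT bb.
  by apply: H; exists B, b.
exists B, b; split=> // psi S0psi.
have [->//|npsi'] := pselect (psi = phi).
by move/Hchi: chib; apply; split.
Qed.

(** The parameters of the separating formula are quantified; finitely many
    equations tie them to the variables on which [phi] depends. *)
Lemma separated_reindex A (V W : Type) (s : W -> V) (a : V -> A) :
  separated a -> separated (a \o s).
Proof.
move=> asep phi; rewrite -sat_prename => /asep[psi psia inc].
have [D finD HD] := finite_support phi.
pose S : set (pform L (W + V)) :=
  [set prename inr psi] `|`
  [set PEq (Var L (inl w)) (Var L (inr (s w))) | w in D].
have finS : finite_set S.
  by rewrite finite_setU; split; [exact: finite_set1|exact: finite_image].
have [chi Hchi] := finite_conj finS.
have [theta Htheta] := projection chi.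
exists theta.
  apply/Htheta; exists a; apply/Hchi => _ [->|[w _ <-]] //.
  by rewrite sat_prename.
move=> B b BT [phib /Htheta[c /Hchi bc]].
apply: (inc B c BT); split; last first.
  by have := bc _ (or_introl erefl); rewrite sat_prename.
rewrite sat_prename; apply: HD phib => w /set_mem Dw.
by apply: (bc (PEq (Var L (inl w)) (Var L (inr (s w))))); right; exists w.
Qed.

Lemma separated_same_type A B (V : Type) (a : V -> A) (b : V -> B) :
  separated a -> models B T -> (forall phi, sat phi a -> sat phi b) ->
  same_type a b.
Proof.
move=> asep BT ab phi; split=> [|phib]; first exact: ab.
apply: contrapT => /asep[psi psia inc].
by apply: (inc B b BT); split=> //; exact: ab.
Qed.

(** Maximality holds for the family of all elements of [A], as a map preserving
    its type is a homomorphism. *)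
Lemma pec_separated A (V : Type) (a : V -> A) : pec T A -> separated a.
Proof.
move=> [AT Apec]; apply: (@separated_reindex A A V a id).
apply: maximal_separated => B b BT Hb phi phib.
have bhom : homomorphism b.
  move=> r chi c chic; rewrite -sat_prename; apply: Hb.
  by rewrite sat_prename.
by apply/(immersion_same_type _ (Apec B b BT bhom)).
Qed.

Section TypesOverParameters.
Variables (U : structure L) (B V : Type) (f : B -> U).

Lemma maximal_type_realized (p : set (pform L (V + B))) : maximal_type T f p ->
  exists N (h : U -> N) (a : V -> N), [/\ models N T, homomorphism h &
    p = [set phi | sat phi (vjoin a (h \o f))]].
Proof.
move=> [[N [h [a [NT hhom Hp]]]] pmax]; exists N, h, a; split=> //.
by apply/esym/pmax => //; exists N, h, a.
Qed.

End TypesOverParameters.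

(** A larger type would again be that of a tuple of a model into which [U]
    maps, since [U] is among the variables. *)
Lemma global_type_separated (U : structure L) (V : Type)
    (p : set (pform L (V + U))) (N : structure L) (h : U -> N) (a : V -> N) :
  maximal_type T id p -> homomorphism h ->
  p = [set phi | sat phi (vjoin a h)] -> separated (vjoin a h).
Proof.
move=> [_ pmax] hhom pE; apply: maximal_separated => B b BT Hb.
have bhom : homomorphism (b \o inr).
  move=> r phi c phic; rewrite -compA -sat_prename; apply: Hb.
  by rewrite sat_prename; exact: hhom.
have bE : [set phi | sat phi b] = p.
  apply: pmax; last by rewrite pE => phi /= /Hb.
  exists B, (b \o inr), (b \o inl); split=> // phi /= phib.
  by rewrite (vjoinK b).
by move=> phi phib; move: bE; rewrite pE => /seteqP[+ _]; exact.
Qed.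

End Types.

(** * Morley sequences of an invariant type *)

(** The type [X] bounds the cardinality of the parameter families; it is closed
    under pairing, so all the families and sets of formulas below embed in it.
    The global type is represented by [al] and [h : U -> N]: a formula over [U]
    belongs to it when it holds of [al] and of the image under [h] of its
    parameters. *)
Section Morley.
Variables (L : language) (T : theory L) (K : Type) (U : structure L).
Hypothesis U_monster : monster T K U.
Variables (X : Type) (pr : X -> X -> X).
Hypotheses (L_countable : countable_language L) (X_small : small K [set: X])
  (natX : embeds nat X) (prI : inj2 pr).
Variables (M : structure L) (e : M -> U).
Hypothesis MX : embeds M X.

Let U_pec : pec T U. Proof. by have [] := U_monster. Qed.

Lemma embeds_sum (A B : Type) : embeds A X -> embeds B X -> embeds (A + B) X.
Proof.
move=> [f fI] [g gI]; have [k kI] := natX.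
exists (fun v => match v with inl a => pr (k 0) (f a) | inr b => pr (k 1) (g b) end).
by move=> [a|b] [a'|b'] /prI[/kI // _]; [move/fI->|move/gI->].
Qed.

Lemma embeds_countType (A : countType) : embeds A X.
Proof.
by apply: embeds_trans natX; exists pickle; exact: pcan_inj pickleK.
Qed.

Lemma saturation (V B : Type) (d : B -> U) (S : set (pform L (V + B))) :
  embeds V X -> embeds B X ->
  (forall S0, S0 `<=` S -> finite_set S0 ->
     exists a : V -> U, forall phi, S0 phi -> sat phi (vjoin a d)) ->
  exists a : V -> U, forall phi, S phi -> sat phi (vjoin a d).
Proof.
move=> VX BX Sfin; have [_ _ Usat] := U_monster.
pose s (v : V + B) : V + U := match v with inl v => inl v | inr b => inr (d b) end.
have E a : vjoin a id \o s = vjoin a d by apply: funext => -[].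
have [|S' S'S finS'|a Ha] := Usat V (prename s @` S).
- have [k kI] := natX.
  apply: card_lt_le X_small; apply: card_le_trans (card_image_le _ _) _.
  apply: card_le_trans (card_leT _) _; apply: embeds_card.
  by apply: (pform_code L_countable kI prI); exact: embeds_sum.
- have /choice[g Hg] : forall psi, exists phi, S' psi -> S phi /\ prename s phi = psi.
    move=> psi; have [/S'S[phi ? ?]|] := pselect (S' psi); first by exists phi.
    by exists (PTop L _).
  have [||a Ha] := Sfin (g @` S').
  + by move=> _ [psi S'psi <-]; have [] := Hg _ S'psi.
  + exact: finite_image.
  exists a => psi S'psi; have [_ <-] := Hg _ S'psi.
  by rewrite sat_prename E; apply: Ha; exists psi.
- by exists a => phi Sphi; rewrite -E -sat_prename; apply: Ha; exists phi.
Qed.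

(** A finite part of the type of [b] is realized in [U] because [h], being a
    homomorphism from a pec model, reflects the formula that says so. *)
Lemma realization (N : structure L) (h : U -> N) (V B : Type) (b : V -> N)
    (d : B -> U) : homomorphism h -> models N T -> embeds V X -> embeds B X ->
  exists a : V -> U, forall phi, sat phi (vjoin b (h \o d)) -> sat phi (vjoin a d).
Proof.
move=> hhom NT VX BX.
apply: (saturation (S := [set phi | sat phi (vjoin b (h \o d))])) => // S0 S0S finS0.
have [chi Hchi] := finite_conj finS0.
pose swap (v : V + B) : B + V := match v with inl v => inr v | inr b => inl b end.
have E C (f : B -> C) (g : V -> C) : vjoin f g \o swap = vjoin g f.
  by apply: funext => -[].
have [theta Htheta] := projection (prename swap chi).
have : sat theta d.
  apply/(immersion_same_type _ (U_pec.2 N h NT hhom)).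
  by apply/Htheta; exists b; rewrite sat_prename E; apply/Hchi.
by move=> /Htheta[a]; rewrite sat_prename E => /Hchi ?; exists a.
Qed.

Variables (n : nat) (N : structure L) (h : U -> N) (al : 'I_n -> N).
Hypotheses (N_models : models N T) (h_hom : homomorphism h)
  (al_separated : separated T (vjoin al h))
  (al_invariant : forall r (c c' : 'I_r -> U),
     same_type (vjoin c e) (vjoin c' e) ->
     same_type (vjoin al (h \o c)) (vjoin al (h \o c'))).

(** Invariance extends from tuples to families, since a formula uses only
    finitely many parameters. *)
Lemma invariant_family (B : Type) (b0 : B) (d d' : B -> U) :
  same_type (vjoin d e) (vjoin d' e) ->
  same_type (vjoin al (h \o d)) (vjoin al (h \o d')).
Proof.
move=> dd' phi; have [r [s [phi' E]]] := finite_variables phi; rewrite !E.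
pose s1 (i : 'I_r) : 'I_n + 'I_r := if s i is inl j then inl j else inr i.
pose s2 (i : 'I_r) : B := if s i is inr b then b else b0.
have split_s (f : B -> U) :
    vjoin al (h \o f) \o s = vjoin al (h \o (f \o s2)) \o s1.
  by apply: funext => i; rewrite /s1 /=; case si: (s i) => [//|b]; rewrite /= /s2 si.
rewrite !split_s; apply: same_type_reindex; apply: al_invariant.
pose t (v : 'I_r + M) : B + M := match v with inl i => inl (s2 i) | inr x => inr x end.
have vE (f : B -> U) : vjoin (f \o s2) e = vjoin f e \o t by apply: funext => -[].
by rewrite !vE; exact: same_type_reindex.
Qed.

(** Since [p] is the type of [al] over the image of [U], its restriction to the
    parameters [d] is the type of [al] over [h \o d]. *)
Definition realizes_over (a : 'I_n -> U) (B : Type) (d : B -> U) : Prop :=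
  same_type (vjoin a d) (vjoin al (h \o d)).

Lemma realizes_over_reindex a (B C : Type) (d : B -> U) (s : C -> B) :
  realizes_over a d -> realizes_over a (d \o s).
Proof.
pose t (v : 'I_n + C) : 'I_n + B := match v with inl i => inl i | inr c => inr (s c) end.
have E (A : Type) (f : 'I_n -> A) (g : B -> A) : vjoin f (g \o s) = vjoin f g \o t.
  by apply: funext => -[].
by rewrite /realizes_over compA !E; exact: same_type_reindex.
Qed.

Lemma exists_realizes_over (B : Type) (d : B -> U) : embeds B X ->
  exists a, realizes_over a d.
Proof.
move=> BX.
have [a Ha] := realization al d h_hom N_models (embeds_countType _) BX.
exists a; apply: same_type_sym; apply: separated_same_type U_pec.1 Ha.
pose t (v : 'I_n + B) : 'I_n + U := match v with inl i => inl i | inr b => inr (d b) end.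
have -> : vjoin al (h \o d) = vjoin al h \o t by apply: funext => -[].
exact: separated_reindex.
Qed.

(** Parameters are kept as families, not as sets, so that repetitions among them
    are harmless. That of [M] and the first [k] terms of a sequence grows by one
    tuple when [k] does, hence the recursion. *)
Fixpoint seg_index (k : nat) : Type :=
  if k is k'.+1 then ('I_n + seg_index k')%type else M.

Fixpoint segment (a : nat -> 'I_n -> U) (k : nat) : seg_index k -> U :=
  match k return seg_index k -> U with
  | 0 => e
  | k'.+1 => vjoin (a k') (@segment a k')
  end.
Arguments segment : clear implicits.

Lemma embeds_seg_index k : embeds (seg_index k) X.
Proof. by elim: k => //= k IH; apply: embeds_sum => //; exact: embeds_countType. Qed.

Lemma eq_segment a a' k : (forall i, i < k -> a i = a' i) -> segment a k = segment a' k.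
Proof.
elim: k => //= k IH aa'; rewrite aa' // IH // => i ik; apply: aa'.
exact: ltnW.
Qed.

Lemma segment_prefix j k : j <= k ->
  exists s : seg_index j -> seg_index k, forall a, segment a j = segment a k \o s.
Proof.
elim: k => [|k IH]; first by rewrite leqn0 => /eqP->; exists id.
rewrite leq_eqVlt => /orP[/eqP->|/IH[s Hs]]; first by exists id.
by exists (inr \o s) => a; rewrite Hs.
Qed.

Lemma segment_nth i k : i < k ->
  exists s : 'I_n -> seg_index k, forall a, a i = segment a k \o s.
Proof.
by move=> /segment_prefix[s Hs]; exists (s \o inl) => a; rewrite compA -Hs.
Qed.

Lemma segment_subseq (f : nat -> nat) i k : (forall j, j < i -> f j < k) ->
  exists s : seg_index i -> seg_index k,
    forall a, segment (a \o f) i = segment a k \o s.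
Proof.
elim: i => [|i IH] fk; first exact: (segment_prefix (leq0n k)).
have [|s Hs] := IH; first by move=> j ji; apply: fk; exact: ltnW.
have [t Ht] := segment_nth (fk i (leqnn _)).
by exists (vjoin t s) => a; rewrite vjoin_comp -Hs -Ht.
Qed.

Lemma segment_flat k : exists s : seg_index k -> nat * 'I_n + M,
  forall a, segment a k = vjoin (fun v => a v.1 v.2) e \o s.
Proof.
elim: k => [|k [s Hs]]; first by exists inr.
exists (vjoin (fun i => inl (k, i)) s) => a.
by rewrite vjoin_comp -Hs.
Qed.

Definition morley (a : nat -> 'I_n -> U) (k : nat) : Prop :=
  forall i, i < k -> realizes_over (a i) (segment a i).

Lemma morley_le a j k : j <= k -> morley a k -> morley a j.
Proof. by move=> jk ak i ij; apply: ak; exact: leq_trans jk. Qed.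

Lemma invariant_segment a a' k :
  same_type (segment a k) (segment a' k) ->
  same_type (vjoin al (h \o segment a k)) (vjoin al (h \o segment a' k)).
Proof.
move=> aa'; have [s Hs] := segment_prefix (leq0n k).
have [x0] := carrier_inhabited M; apply: (invariant_family (s x0)).
have E f : vjoin (segment f k) e = segment f k \o vjoin id s.
  by rewrite vjoin_comp -(Hs f).
by rewrite !E; exact: same_type_reindex.
Qed.

(** The next term has over the segment the type of [al], which by invariance
    depends only on the type of the segment. *)
Lemma morley_same_type a a' k : morley a k -> morley a' k ->
  same_type (segment a k) (segment a' k).
Proof.
elim: k => [//|k IH] ak ak'.
apply: (same_type_trans (ak k (leqnn _))).
apply: same_type_trans (same_type_sym (ak' k (leqnn _))).
by apply: invariant_segment; apply: IH; [exact: morley_le ak|exact: morley_le ak'].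
Qed.

Lemma morley_transfer a a' k : morley a k ->
  same_type (segment a k) (segment a' k) -> morley a' k.
Proof.
move=> ak aa' i ik.
have prefix j : j <= k -> same_type (segment a j) (segment a' j).
  by move=> /segment_prefix[s Hs]; rewrite !Hs; exact: same_type_reindex.
apply: (same_type_trans (same_type_sym (prefix i.+1 ik))).
apply: (same_type_trans (ak i ik)).
by apply: invariant_segment; exact/prefix/ltnW.
Qed.

Lemma morley_subseq a (f : nat -> nat) i k : morley a k ->
  (forall j, j < i -> f j < k) -> (forall j l, j < l -> f j < f l) ->
  morley (a \o f) i.
Proof.
move=> ak fk fI j ji; have [s Hs] := segment_subseq (fun l lj => fI l j lj).
by rewrite Hs; apply: realizes_over_reindex; exact/ak/fk.
Qed.

(** The new term is taken over [c] as well, so that the formulas of the type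
    over [c] hold of it. *)
Lemma morley_extend a k m (c : 'I_m -> U) : morley a k ->
  exists a', [/\ forall i, i < k -> a' i = a i, morley a' k.+1
    & realizes_over (a' k) c].
Proof.
move=> ak; have [a1 Ha1] := exists_realizes_over (vjoin (segment a k) c)
  (embeds_sum (embeds_seg_index k) (embeds_countType _)).
pose a' i := if i == k then a1 else a i.
have a'a i : i < k -> a' i = a i by rewrite /a' => /ltn_eqF->.
exists a'; split=> // [i|]; last first.
  by rewrite /a' eqxx; exact: (realizes_over_reindex inr Ha1).
rewrite ltnS leq_eqVlt => /orP[/eqP->|ik].
  rewrite (eq_segment a'a) /a' eqxx.
  exact: (realizes_over_reindex inl Ha1).
rewrite a'a // (eq_segment (a' := a)); first exact: ak.
by move=> j ji; apply: a'a; exact: ltn_trans ji ik.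
Qed.

Lemma exists_morley k : exists a, morley a k.
Proof.
elim: k => [|k [a ak]].
  by have [x] := carrier_inhabited U; exists (fun _ _ => x).
have [x] := carrier_inhabited U.
by have [a' [_ ? _]] := morley_extend (fun _ : 'I_0 => x) ak; exists a'.
Qed.

Section Alternation.
Variables (m : nat) (phi psi : pform L ('I_n + 'I_m)).

(** The flag [s] fixes how the alternation starts rather than how it ends, so
    that a sequence stays alternating when it is prolonged. *)
Definition alt_formula (s : bool) (i : nat) := if s (+) odd i then phi else psi.

Definition alternates (s : bool) (k : nat) (c : 'I_m -> U) : Prop :=
  exists a, morley a k /\ forall i, i < k -> sat (alt_formula s i) (vjoin (a i) c).

(** The positive formulas over [M] which follow from alternation imply it: by
    saturation they give a sequence which alternates on [c] and satisfies all
    that Morley sequences of length [k] have in common, hence is one of them. *)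
Lemma alternates_closed (s : bool) (k : nat) (c : 'I_m -> U) :
  (forall theta : pform L ('I_m + M),
     (forall c', alternates s k c' -> sat theta (vjoin c' e)) ->
     sat theta (vjoin c e)) ->
  alternates s k c.
Proof.
move=> cth.
pose S : set (pform L (nat * 'I_n + ('I_m + M))) := [set chi | forall a' c',
  morley a' k -> (forall i, i < k -> sat (alt_formula s i) (vjoin (a' i) c')) ->
  sat chi (vjoin (fun v => a' v.1 v.2) (vjoin c' e))].
have [||S0 S0S finS0|b Sb] := saturation (S := S) (d := vjoin c e).
- exact: embeds_countType.
- by apply: embeds_sum => //; exact: embeds_countType.
- have [chi Hchi] := finite_conj finS0.
  pose swap (v : nat * 'I_n + ('I_m + M)) : ('I_m + M) + nat * 'I_n :=
    match v with inl v => inr v | inr b => inl b end.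
  have E (f : 'I_m + M -> U) (g : nat * 'I_n -> U) :
    vjoin f g \o swap = vjoin g f by apply: funext => -[].
  have [theta Htheta] := projection (prename swap chi).
  have /Htheta[b] : sat theta (vjoin c e).
    apply: cth => c' [a' [a'k alta']]; apply/Htheta.
    exists (fun v => a' v.1 v.2); rewrite sat_prename E.
    by apply/Hchi => xi /S0S; exact.
  by rewrite sat_prename E => /Hchi ?; exists b.
pose a i l := b (i, l).
have bE : b = fun v => a v.1 v.2 by apply: funext => -[].
have [a0 a0k] := exists_morley k.
have [t Ht] := segment_flat k.
exists a; split.
  apply: (morley_transfer a0k); apply: (separated_same_type (T := T)).
  - exact: pec_separated.
  - exact: U_pec.1.
  move=> xi a0xi.
  pose t' (v : seg_index k) : nat * 'I_n + ('I_m + M) :=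
    match t v with inl v => inl v | inr x => inr (inr x) end.
  have E f c' : segment f k = vjoin (fun v => f v.1 v.2) (vjoin c' e) \o t'.
    by rewrite Ht; apply: funext => v /=; rewrite /t'; case: (t v).
  rewrite (E a c) -sat_prename -bE; apply: Sb => a' c' a'k _.
  by rewrite sat_prename -E; apply/(morley_same_type a0k a'k).
move=> i ik.
pose u (v : 'I_n + 'I_m) : nat * 'I_n + ('I_m + M) :=
  match v with inl l => inl (i, l) | inr j => inr (inl j) end.
have E f c' : vjoin (f i) c' = vjoin (fun v => f v.1 v.2) (vjoin c' e) \o u.
  by apply: funext => -[].
rewrite E -sat_prename -bE; apply: Sb => a' c' _ alta'.
by rewrite sat_prename -E; exact: alta'.
Qed.

Lemma alternates_next s k (c : 'I_m -> U) :
  sat (alt_formula s k) (vjoin al (h \o c)) -> alternates s k c ->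
  alternates s k.+1 c.
Proof.
move=> altk [a [ak alta]]; have [a' [a'a a'k a'c]] := morley_extend c ak.
exists a'; split=> // i; rewrite ltnS leq_eqVlt => /orP[/eqP->|ik].
  by apply/a'c.
by rewrite a'a //; exact: alta.
Qed.

Hypothesis phi_psi : incompatible T phi psi.

(** By indiscernibility, an alternating sequence of length [2 * k] yields for
    each [W] a parameter which cuts out [W] on one and the same sequence: pick
    from each pair of consecutive terms the one with the wanted formula. *)
Lemma alternates_shatter s k (c : 'I_m -> U) : alternates s k.*2 c ->
  exists a : nat -> 'I_n -> U, forall W : set nat, exists c' : 'I_m -> U,
    forall i, i < k ->
      (W i -> sat phi (vjoin (a i) c')) /\ (~ W i -> sat psi (vjoin (a i) c')).
Proof.
move=> [a [ak alta]]; exists a => W.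
pose f i := i.*2 + (s (+) `[<W i>]).
have flt j l : j < l -> f j < f l.
  rewrite /f -!muln2; case: (_ (+) _); case: (_ (+) _) => /=; lia.
have fk j : j < k -> f j < k.*2.
  rewrite /f -!muln2; case: (_ (+) _) => /=; lia.
have afk : morley (a \o f) k by apply: (morley_subseq ak).
(* The term [2 * i + b] has the formula wanted for [i] when [s (+) b] tells
   whether [W i]. *)
pose wanted i := if `[<W i>] then phi else psi.
have wantedE i : wanted i = alt_formula s (f i).
  rewrite /alt_formula /f oddD odd_double /= oddb addbA addbb.
  by rewrite addFb.
have /dep_choice[t Ht] : forall i : 'I_k, exists t : 'I_n -> seg_index k,
    forall b, b (i : nat) = segment b k \o t by move=> i; exact: segment_nth.
pose t' (i : 'I_k) (v : 'I_n + 'I_m) : seg_index k + 'I_m :=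
  match v with inl l => inl (t i l) | inr j => inr j end.
have E b c' (i : 'I_k) : vjoin (segment b k) c' \o t' i = vjoin (b i) c'.
  by rewrite (Ht i b); apply: funext => -[].
pose S := range (fun i : 'I_k => prename (t' i) (wanted i)).
have finS : finite_set S by apply: finite_image; exact: finite_finset.
have [chi Hchi] := finite_conj finS.
have [theta Htheta] := projection chi.
have : sat theta (segment (a \o f) k).
  apply/Htheta; exists c; apply/Hchi => _ [i _ <-].
  by rewrite sat_prename E wantedE; apply: alta; exact: fk.
have ak' : morley a k by apply: morley_le ak; rewrite -addnn leq_addr.
move=> /(morley_same_type afk ak')/Htheta[c' /Hchi Hc']; exists c' => i ik.
have := Hc' (prename (t' (Ordinal ik)) (wanted i)).
rewrite sat_prename E /wanted => /(_ (imageP _ I)).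
by case: asboolP => Wi; split.
Qed.

Lemma alternates_le s j k (c : 'I_m -> U) :
  j <= k -> alternates s k c -> alternates s j c.
Proof.
move=> jk [a [ak alta]]; exists a; split; first exact: morley_le ak.
by move=> i ij; apply: alta; exact: leq_trans jk.
Qed.

Lemma finite_nat_bounded (D : set nat) : finite_set D ->
  exists k, forall i, D i -> i < k.
Proof.
move=> /finite_seqP[l ->]; elim: l => [|j l [k Hk]]; first by exists 0.
exists (maxn j.+1 k) => i /=; rewrite inE => /orP[/eqP->|/Hk]; lia.
Qed.

(** Otherwise every finite length is shattered, hence the finite parts of the
    independence pattern are realized in [U]. *)
Lemma alternates_bounded : ~ has_IP T phi ->
  exists b, forall s k (c : 'I_m -> U), alternates s k c -> k < b.
Proof.
move=> nIP; apply: contrapT => unbounded; apply: nIP.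
exists psi; split; first by move=> A a b AT; exact: phi_psi.
have shatter k : exists (a : nat -> 'I_n -> U) (c : set nat -> 'I_m -> U),
    forall W i, i < k -> (W i -> sat phi (vjoin (a i) (c W))) /\
      (~ W i -> sat psi (vjoin (a i) (c W))).
  apply: contrapT => nk; apply: unbounded; exists k.*2 => s j c altj.
  rewrite ltnNge; apply/negP => kj; apply: nk.
  by have [a /choice[b ab]] := alternates_shatter (alternates_le kj altj); exists a, b.
pose V := (nat * 'I_n + set nat * 'I_m)%type.
pose t i (W : set nat) (v : 'I_n + 'I_m) : V :=
  match v with inl l => inl (i, l) | inr j => inr (W, j) end.
pose wanted i (W : set nat) := prename (t i W) (if `[<W i>] then phi else psi).
have E A (f : V -> A) i W : f \o t i W =
    vjoin (fun l => f (inl (i, l))) (fun j => f (inr (W, j))).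
  by apply: funext => -[].
have [S0 S0S finS0|A [f [AT Hf]]] := @compactness L T V
    [set wanted x.1 x.2 | x in [set: nat * set nat]].
  have /choice[g Hg] : forall chi, exists i, S0 chi -> exists W, wanted i W = chi.
    move=> chi; have [/S0S[[i W] _ <-]|] := pselect (S0 chi); first by exists i; exists W.
    by exists 0.
  have [k Hk] := finite_nat_bounded (finite_image g finS0).
  have [a [c Hac]] := shatter k.
  exists U, (vjoin (fun v => a v.1 v.2) (fun v => c v.1 v.2)); split; first exact: U_pec.1.
  move=> chi S0chi; have [W <-] := Hg _ S0chi.
  rewrite sat_prename E /=.
  have [phiW psiW] := Hac W _ (Hk _ (imageP g S0chi)).
  by case: asboolP.
exists A, (fun i l => f (inl (i, l))), (fun W j => f (inr (W, j))); split=> // i W.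
have := Hf (wanted i W) (ex_intro2 _ _ (i, W) I erefl).
by rewrite sat_prename E; case: asboolP.
Qed.

End Alternation.

(** If [phi] is in the type, a maximal alternating sequence which ends in [phi]
    cannot be followed by [psi], as one more [phi] would come after. If not,
    some [psi] incompatible with [phi] is in the type, and any sequence which
    ends in [phi] is followed by [psi]. The parity [odd k] makes a sequence of
    length [k] end in [phi]. *)
Lemma membership_by_alternation m (phi : pform L ('I_n + 'I_m)) (c : 'I_m -> U) :
  ~ has_IP T phi ->
  sat phi (vjoin al (h \o c)) <->
  forall psi, incompatible T phi psi -> exists k,
    alternates phi psi (odd k) k c /\ ~ alternates phi psi (odd k) k.+1 c.
Proof.
move=> nIP; split=> [phic psi inc|alt].
  have [b Hb] := alternates_bounded inc nIP.
  pose P k := `[<alternates phi psi (odd k) k c>].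
  have P0 : exists k, P k.
    have [a a0] := exists_morley 0.
    by exists 0; apply/asboolP; exists a; split.
  have Pb k : P k -> k <= b by move=> /asboolP/Hb/ltnW.
  case: (ex_maxnP P0 Pb) => k /asboolP altk kmax; exists k; split=> // altk1.
  suff /kmax : P k.+2 by rewrite ltnNge leqnSn.
  apply/asboolP; rewrite /= negbK; apply: alternates_next altk1.
  by rewrite /alt_formula /= addbN addbb.
apply: contrapT => nphi.
pose t (v : 'I_n + 'I_m) : 'I_n + U := match v with inl l => inl l | inr j => inr (c j) end.
have tE : vjoin al (h \o c) = vjoin al h \o t by apply: funext => -[].
have [psi psic inc] : exists2 psi, sat psi (vjoin al (h \o c)) & incompatible T phi psi.
  by rewrite tE; apply: (separated_reindex al_separated); rewrite -tE.
have [k [altk []]] := alt psi inc.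
by apply: alternates_next altk; rewrite /alt_formula addbb.
Qed.

End Morley.

(** * Borel sets of types *)

Section TypeSpace.
Variables (L : language) (T : theory L) (U M : structure L) (e : M -> U) (m : nat).
Local Notation Sy := (type_space T e m).

Lemma open_neg_set (theta : pform L ('I_m + M)) : open (@neg_set L T U M e m theta).
Proof.
exists [set @neg_set L T U M e m theta]; last by rewrite bigcup_set1.
by move=> _ ->; apply: (@finI_from1 _ _ (@neg_sets L T U M e m) id); exists theta.
Qed.

Lemma Borel_bigcup (F : nat -> set Sy) : (forall i, Borel (F i)) -> Borel (\bigcup_i F i).
Proof. by move=> FB; exact: (@sigma_algebra_bigcup Sy setT open F FB). Qed.

Lemma Borel_setC (A : set Sy) : Borel A -> Borel (~` A).
Proof.
by rewrite -setTD => BA; exact: (@sigma_algebraCD Sy setT open A BA).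
Qed.

Lemma Borel_set0 : Borel (set0 : set Sy).
Proof. exact: (@sigma_algebra0 Sy setT open). Qed.

Lemma Borel_bigcap (F : nat -> set Sy) : (forall i, Borel (F i)) -> Borel (\bigcap_i F i).
Proof.
move=> FB; rewrite -[X in Borel X]setCK setC_bigcap; apply: Borel_setC.
by apply: Borel_bigcup => i; exact: Borel_setC.
Qed.

Lemma Borel_setI (A B : set Sy) : Borel A -> Borel B -> Borel (A `&` B).
Proof.
move=> BA BB; rewrite -bigcap2E; apply: Borel_bigcap => -[|[|i]] //=.
rewrite -setC0; apply: Borel_setC; exact: Borel_set0.
Qed.

(** Such a set is closed. *)
Lemma Borel_all_in (Th : set (pform L ('I_m + M))) :
  Borel [set q : Sy | Th `<=` sval q].
Proof.
have -> : [set q : Sy | Th `<=` sval q] =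
    ~` \bigcup_(theta in Th) @neg_set L T U M e m theta.
  rewrite setC_bigcup; apply/seteqP; split=> q /= H theta Ththeta.
    by move=> nq; apply: nq; exact: H.
  by apply: contrapT => nq; exact: (H _ Ththeta nq).
apply: Borel_setC; apply: sub_sigma_algebra.
by apply: bigcup_open => theta _; exact: open_neg_set.
Qed.

End TypeSpace.

Section Realizations.
Variables (L : language) (T : theory L) (K : Type) (U : structure L).
Hypothesis U_monster : monster T K U.

(** A tuple of [U] which realizes [q] has a consistent type that contains [q]. *)
Lemma realizesE (B V : Type) (f : B -> U) (c : V -> U)
    (q : set (pform L (V + B))) : maximal_type T f q -> realizes f c q ->
  q = [set theta | sat theta (vjoin c f)].
Proof.
move=> [_ qmax] cq; apply/esym/qmax => //.
have [[UT _] _ _] := U_monster.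
exists U, id, c; split=> //.
Qed.

End Realizations.

Theorem corollary6p44 (L : language) (T : theory L)
  (T_positive : positive_theory T) (T_JCP : JCP T)
  (L_countable : countable_language L) (T_NIP : NIP T)
  (K : Type) (K_large : card_lt [set: nat] [set: K])
  (U : structure L) (U_monster : monster T K U)
  (M : structure L) (M_pec : pec T M) (M_small : small K [set: M])
  (e : M -> U) (e_immersion : immersion e)
  (n m : nat) (phi : pform L ('I_n + 'I_m))
  (p : set (pform L ('I_n + U))) (p_global : global_type T p)
  (p_invariant : invariant_over e p) :
  @Borel (type_space T e m) (@def_set L T U M e n m p phi).
Proof.
have [X [X_small natX MX [pr prI]]] := small_pairing_type K_large M_small.
have [N [h [al [NT hhom pE]]]] := maximal_type_realized p_global.
have al_sep := global_type_separated p_global hhom pE.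
have p_inst r (xi : pform L ('I_n + 'I_r)) (c : 'I_r -> U) :
    p (inst xi c) <-> sat xi (vjoin al (h \o c)).
  rewrite pE /= /inst sat_prename (_ : _ \o _ = vjoin al (h \o c)) //.
  by apply: funext => -[].
have al_inv r (c c' : 'I_r -> U) : same_type (vjoin c e) (vjoin c' e) ->
    same_type (vjoin al (h \o c)) (vjoin al (h \o c')).
  by move=> cc' xi; rewrite -!p_inst; exact: p_invariant.
pose alts := @alternates L U M e n N h al m phi.
pose Th psi s k := [set theta : pform L ('I_m + M) |
  forall c, alts psi s k c -> sat theta (vjoin c e)].
pose E psi s k : set (type_space T e m) := [set q | Th psi s k `<=` sval q].
have EP (q : type_space T e m) psi s k c : realizes e c (sval q) ->
    E psi s k q <-> alts psi s k c.
  move=> cq; rewrite /E /mkset (realizesE U_monster (svalP q) cq); split=> [H|H th].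
    exact: (alternates_closed U_monster L_countable X_small natX prI MX NT hhom
      al_sep al_inv H).
  by apply.
have qreal (q : type_space T e m) : exists c, realizes e c (sval q).
  have [N' [h' [b [N'T h'hom qE]]]] := maximal_type_realized (svalP q).
  have [c Hc] := realization U_monster L_countable X_small natX prI b e h'hom N'T
    (embeds_countType natX _) MX.
  by exists c => th; rewrite qE => /Hc.
(* An enumeration of the formulas [psi]. *)
have [code codeI] : embeds (pform L ('I_n + 'I_m)) nat.
  have [pn pnI] : exists pr : nat -> nat -> nat, inj2 pr.
    by apply: square_embeds; exists id.
  apply: (pform_code L_countable (k := id) _ pnI) => //.
  exact: (embeds_countType (ex_intro _ id (fun _ _ => id))).
pose G i : set (type_space T e m) := [set q | forall psi, code psi = i ->
  incompatible T phi psi -> exists k, E psi (odd k) k q /\ ~ E psi (odd k) k.+1 q].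
suff -> : @def_set L T U M e n m p phi = \bigcap_i G i.
  apply: Borel_bigcap => i.
  have [[psi [psii inc]]|no] :=
    pselect (exists psi, code psi = i /\ incompatible T phi psi); last first.
    rewrite (_ : G i = ~` set0); first by apply: Borel_setC; exact: Borel_set0.
    rewrite setC0; apply/seteqP; split=> // q _ psi psii inc.
    by case: no; exists psi.
  rewrite (_ : G i = \bigcup_k (E psi (odd k) k `&` ~` E psi (odd k) k.+1)).
    apply: Borel_bigcup => k; apply: Borel_setI; last apply: Borel_setC;
    exact: Borel_all_in.
  apply/seteqP; split=> [q /(_ psi psii inc)[k [Ek nEk]]|q [k _ [Ek nEk]] psi'].
    by exists k.
  by rewrite -psii => /codeI -> _; exists k.
apply/seteqP; split=> [q [c cq pc] i _ psi _ inc|q Gq].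
  move/p_inst: pc => /(membership_by_alternation U_monster L_countable X_small
    natX prI MX NT hhom al_sep al_inv c (T_NIP n m phi))/(_ psi inc)[k [altk naltk]].
  by exists k; split; [apply/(EP _ _ _ _ _ cq)|move=> /(EP _ _ _ _ _ cq)].
have [c cq] := qreal q; exists c => //; apply/p_inst.
apply/(membership_by_alternation U_monster L_countable X_small
    natX prI MX NT hhom al_sep al_inv c (T_NIP n m phi)) => psi inc.
have [k [Ek nEk]] := Gq (code psi) I psi erefl inc.
by exists k; split; [apply/(EP _ _ _ _ _ cq)|move=> alt; apply: nEk; apply/(EP _ _ _ _ _ cq)].
Qed.
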